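(* Let $X$ be a discrete-time time-homogeneous Markov chain on a countable set $V$ with transition matrix $P=(p_{xy})_{x,y\in V}$. Consider the following conditions. (a) There exist a finite nonempty set $K\subset V$ and constants $\nu_K>0$, $\rho_K<1$, $M_K<\infty$ such that for all $n$, $\sup_{x\in K}\big|\big(\sum_{y\in K}p^n_{xy}\big)-\nu_K\big|\le M_K\rho_K^n$, where $p^n_{xy}$ are the $n$-step transition probabilities. (b) There exist a finite nonempty set $K\subset V$ and a constant $\kappa>1$ such that $\sup_{x\in K}\mathbb{E}_x[\kappa^{T_K}]<\infty$, where $T_K=\inf\{n\ge1:X_n\in K\}$. (c) There exist a finite set $K\subset V$, constants $b<\infty$, $\lambda<1$, $c>0$ and a function $u:V\to[c,\infty)$ such that $Pu(x)\le\lambda u(x)+b1_K(x)$ for all $x\in V$. If (c) holds, then the weak chain compactness condition (defined in the context) holds. If $X$ is irreducible and aperiodic, then any one of (a), (b), (c) implies the weak chain compactness condition.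
   Context: For $f:V\to(0,\infty)$, $Pf(x)=\sum_{y}p_{xy}f(y)$. $\mathbb{E}_x$ is expectation given $X_0=x$. Weak chain compactness condition: there exist functions $u_n:V\to(0,\infty)$, $n\ge0$, such that (i) $Pu_n(x)<\infty$ for all $x\in V$, $n\ge0$; (ii) there is a constant $c>0$ with $u_n(x)\ge c$ for all $x,n$; (iii) for each $x\in V$ there is a constant $C_x$ with $u_n(x)\le C_x$ for all $n$; (iv) $u_n/Pu_n$ converges pointwise to some $\hat u:V\to(0,\infty)$; (v) there exists a constant $\ell>0$ such that $\{x\in V:\log\hat u(x)\le\ell\}$ is finite. *)

(* Defs.v *)
From HB Require Import structures.
From mathcomp Require Import all_boot all_order all_algebra.
From mathcomp Require Import all_classical all_reals all_analysis.
Import Order.TTheory GRing.Theory Num.Theory.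
Import numFieldNormedType.Exports.

Set Implicit Arguments.
Unset Strict Implicit.
Unset Printing Implicit Defensive.

Local Open Scope classical_set_scope.
Local Open Scope ring_scope.

Definition transition_matrix (R : realType) (V : countType) (p : V -> V -> R) : Prop :=
  (forall x y, 0 <= p x y) /\
  (forall x, \esum_(y in [set: V]) (p x y)%:E = 1%E).

(* [Pf p f x] is an unordered sum in [\bar R]: it is [+oo] when it diverges. *)
Definition Pf (R : realType) (V : countType) (p : V -> V -> R) (f : V -> R)
    (x : V) : \bar R :=
  \esum_(y in [set: V]) (p x y * f y)%:E.

Fixpoint nstep (R : realType) (V : countType) (p : V -> V -> R) (n : nat)
    (x y : V) : \bar R :=
  if n is m.+1 then \esum_(z in [set: V]) ((p x z)%:E * nstep p m z y)%E
  else ((x == y)%:R)%:E.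

(* [Pr x] is the law of the chain started at [x].  Since [V] is countable,
   measurability of the fibres of [X n] is measurability for the discrete
   sigma-algebra.  The last clause is the time-homogeneous Markov property
     Pr(X_(n+1) = s_(n+1) | X_0 = s_0, ..., X_n = s_n) = p s_n s_(n+1)
   with the denominator cleared, so that null conditioning events are allowed. *)
Definition markov_chain (R : realType) (V : countType) (p : V -> V -> R)
    (d : measure_display) (Omega : measurableType d)
    (Pr : V -> probability Omega R) (X : nat -> Omega -> V) : Prop :=
  [/\ transition_matrix p,
      forall n y, measurable (X n @^-1` [set y]),
      forall x, Pr x (X 0%N @^-1` [set x]) = 1%E &
      forall x (n : nat) (s : nat -> V),
        Pr x [set w | forall i, (i <= n.+1)%N -> X i w = s i] =
        (Pr x [set w | forall i, (i <= n)%N -> X i w = s i] *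
          (p (s n) (s n.+1))%:E)%E].

Definition irreducible (R : realType) (V : countType) (p : V -> V -> R) : Prop :=
  forall x y, exists n, (0 < nstep p n x y)%E.

Definition is_gcd (S : set nat) (g : nat) : Prop :=
  (forall n, S n -> (g %| n)%N) /\
  (forall k, (forall n, S n -> (k %| n)%N) -> (k %| g)%N).

Definition aperiodic (R : realType) (V : countType) (p : V -> V -> R) : Prop :=
  forall x, is_gcd [set n | (1 <= n)%N /\ (0 < nstep p n x x)%E] 1%N.

(* T_K = inf {n >= 1 : X_n \in K}, equal to [+oo] if K is never hit. *)
Definition return_time (R : realType) (V : countType) (Omega : Type)
    (X : nat -> Omega -> V) (K : set V) (w : Omega) : \bar R :=
  ereal_inf [set (n%:R : R)%:E | n in [set n : nat | (1 <= n)%N /\ K (X n w)]].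

(* The values at infinite [t] are the limits of a ^ t for a > 1. *)
Definition powRe (R : realType) (a : R) (t : \bar R) : \bar R :=
  match t with
  | r%:E => (a `^ r)%:E
  | +oo%E => +oo%E
  | -oo%E => 0%E
  end.

Definition weak_chain_compactness (R : realType) (V : countType)
    (p : V -> V -> R) : Prop :=
  exists (u : nat -> V -> R) (uhat : V -> R),
    (forall n x, 0 < u n x) /\
    (forall x, 0 < uhat x) /\
    [/\ forall x n, (Pf p (u n) x < +oo)%E,
        exists2 c : R, 0 < c & forall x n, c <= u n x,
        forall x, exists C : R, forall n, u n x <= C,
        forall x, u n x / fine (Pf p (u n) x) @[n --> \oo] --> uhat x &
        exists2 l : R, 0 < l & finite_set [set x | ln (uhat x) <= l]].

Definition geometric_convergence (R : realType) (V : countType)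
    (p : V -> V -> R) : Prop :=
  exists (K : set V) (nu rho M : R),
    [/\ finite_set K, K !=set0, 0 < nu, rho < 1 &
        forall n : nat,
          (ereal_sup [set `| \sum_(y \in K) nstep p n x y - nu%:E | | x in K]
            <= (M * rho ^+ n)%:E)%E].

Definition exponential_return (R : realType) (V : countType)
    (d : measure_display) (Omega : measurableType d)
    (Pr : V -> probability Omega R) (X : nat -> Omega -> V) : Prop :=
  exists (K : set V) (kappa : R),
    [/\ finite_set K, K !=set0, 1 < kappa &
        (ereal_sup [set \int[Pr x]_w powRe kappa (return_time R X K w) | x in K]
          < +oo)%E].

Definition geometric_drift (R : realType) (V : countType)
    (p : V -> V -> R) : Prop :=
  exists (K : set V) (b lambda c : R) (u : V -> R),
    [/\ finite_set K, lambda < 1, 0 < c, forall x, c <= u x &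
        forall x, (Pf p u x <= (lambda * u x + b * \1_K x)%:E)%E].

(* Main.v *)
Require Import Defs.
From HB Require Import structures.
From mathcomp Require Import all_boot all_order all_algebra.
From mathcomp Require Import all_classical all_reals all_analysis.
From mathcomp Require Import ring lra.
Import Order.TTheory GRing.Theory Num.Theory.
Import numFieldNormedType.Exports.

Set Implicit Arguments.
Unset Strict Implicit.
Unset Printing Implicit Defensive.

(** Condition (c) gives weak chain compactness by a constant sequence: if
    [u_n = u] is the drift function and [0 < lambda < 1], as may be assumed,
    then [u / Pu] is at least [1 / lambda > 1] off the finite set [K], so its logarithm is bounded below by a positive
    constant there ([drift_weak_chain_compactness]).  It remains to derive (c)
    from (a) or (b) for irreducible chains.

    Both go through one property, [geometric_tail p K]: starting from any point
    of [K], the probability [a_n(x)] of avoiding [K] at the times [1, ..., n]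
    decays geometrically in [n].  It is expressed by the taboo recursion
    [avoid], which involves only the matrix [p].

    From a geometric tail to (c) ([geometric_tail_drift]): for [kappa > 1] close
    to [1], the generating function [G(x) = sum_n kappa^n a_n(x)] is bounded on
    [K] and satisfies [G = 1 + kappa P(G 1_{K^c})].  By this equation the set
    where [G] is finite is closed under transitions of positive probability, so
    it is all of [V] by irreducibility; and [u = G] off [K], [u = 1 / kappa] on
    [K] satisfies [Pu <= G / kappa].

    From (b) to a geometric tail ([exponential_return_tail]): Markov's
    inequality bounds [kappa^n Pr_x(T_K > n)] by the exponential moment, and the
    Markov property bounds [Pr_x(T_K > n)] below by [a_n(x)]
    ([avoid_le_prob]).

    From (a) to a geometric tail ([geometric_convergence_tail]): this is
    an analogue of Kendall's renewal theorem, by an elementary argument on the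
    whole set [K].  Let [k_n(x) = P^n(x, K)] and
    [e_n(x) = E_x(rho^(n - T_K); T_K <= n)].  Decomposing [k_n - nu] at the first
    return to [K], from which [k_m - nu <= M rho^m] for all [m], gives
    [k_n + nu a_n <= nu + M e_n] ([occupation_avoid_le]); as
    [k_n >= nu - M rho^n] on [K], this yields [nu a_n <= M (e_n + rho^n)] there.
    On the other hand, mass leaving [a] enters [e], which is discounted by [rho]
    at each step: [e_(n+1) + a_(n+1) = rho e_n + a_n]
    ([discounted_return_balance]).  So the total [e_n + rho^n + a_n] loses
    [(1 - rho) (e_n + rho^n)] at each step, at least a fixed fraction of itself:
    it decays geometrically ([balance_geometric]), and [a_n] with it. *)

(** * Unordered sums of nonnegative extended reals *)

Section esum_complements.
Local Open Scope classical_set_scope.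
Local Open Scope ring_scope.
Local Open Scope ereal_scope.

Lemma esumZl (R : realType) (T : choiceType) (S : set T) (c : R)
    (f : T -> \bar R) :
  (0 <= c)%R -> (forall t, 0 <= f t) ->
  \esum_(t in S) (c%:E * f t) = c%:E * \esum_(t in S) f t.
Proof.
move=> + f0; rewrite le_eqVlt => /predU1P[<-|c0].
  by rewrite mul0e esum1// => t _; rewrite mul0e.
(* the reverse inequality is this one for [c^-1] *)
have le_scale (b : R) (g : T -> \bar R) : (0 < b)%R -> (forall t, 0 <= g t) ->
    \esum_(t in S) (b%:E * g t) <= b%:E * \esum_(t in S) g t.
  move=> b0 g0; apply: ge_ereal_sup => _ [A fA <-].
  rewrite -ge0_mule_fsumr// lee_pmul2l ?lte_fin//.
  by apply: ereal_sup_ubound; exists A.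
apply/eqP; rewrite eq_le le_scale//=.
have {1}-> : \esum_(t in S) f t = \esum_(t in S) ((c^-1)%:E * (c%:E * f t)).
  by apply: eq_esum => t _; rewrite muleA -EFinM mulVf ?mul1e// gt_eqF.
rewrite -[leRHS]mul1e -(@mulfV _ c) ?gt_eqF// EFinM -muleA.
rewrite lee_pmul2l ?lte_fin//; apply: le_scale; first by rewrite invr_gt0.
by move=> t; rewrite mule_ge0// lee_fin ltW.
Qed.

Lemma esum_exchange (R : realType) (S T : choiceType) (A : set S) (B : set T)
    (f : S -> T -> \bar R) :
  (forall s t, 0 <= f s t) ->
  \esum_(s in A) \esum_(t in B) f s t = \esum_(t in B) \esum_(s in A) f s t.
Proof.
move=> f0; rewrite !esum_esum//.
rewrite (reindex_esum (B `*` A) _ (fun ts => (ts.2, ts.1)))//; split.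
- by case=> t s [].
- by case=> t s [t' s'] _ _ [-> ->].
- by case=> s t [As Bt]; exists (t, s).
Qed.

Lemma esum_nat_recl (R : realType) (f : nat -> \bar R) :
  (forall n, 0 <= f n) ->
  \esum_(n in [set: nat]) f n = f 0%N + \esum_(n in [set: nat]) f n.+1.
Proof.
move=> f0; rewrite -!nneseries_esumT// nneseries_recl//; congr (_ + _).
by rewrite -(nneseries_addn 1)//; apply: eq_eseriesr => n _; rewrite addn1.
Qed.

Lemma esum_geometric_le (R : realType) (C r : R) (f : nat -> \bar R) :
  (0 <= C)%R -> (0 < r < 1)%R -> (forall n, 0 <= f n <= (C * r ^+ n)%:E) ->
  \esum_(n in [set: nat]) f n <= (C / (1 - r))%:E.
Proof.
move=> C0 /andP[r0 r1] fC; have f0 n : 0 <= f n by case/andP: (fC n).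
rewrite -nneseries_esumT//; apply: lime_le; first exact: is_cvg_nneseries.
apply: nearW => n; apply: (@le_trans _ _ (series (geometric C r) n)%:E).
  rewrite /series/= -sumEFin; apply: lee_sum => i _.
  by case/andP: (fC i).
by rewrite lee_fin geometric_le_lim// ger0_norm// ltW.
Qed.

End esum_complements.

(** * The one-step averaging operator *)

Section average_theory.
Local Open Scope classical_set_scope.
Local Open Scope ring_scope.
Local Open Scope ereal_scope.
Variables (R : realType) (V : countType) (p : V -> V -> R).
(** The operator that [Pf] applies to real functions, on extended functions:
    iterating it then needs no finiteness side condition. *)
Definition average  (f : V -> \bar R) (x : V) : \bar R :=
  \esum_(y in [set: V]) ((p x y)%:E * f y).

Hypothesis p_tm : transition_matrix p.

Let p_ge0 x y : 0 <= (p x y)%:E. Proof. by rewrite lee_fin p_tm.1. Qed.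

Lemma PfE (f : V -> R) x : Pf p f x = average (EFin \o f) x.
Proof. by apply: eq_esum => y _; rewrite EFinM. Qed.

Lemma average_ge0 f x : (forall y, 0 <= f y) -> 0 <= average f x.
Proof. by move=> f0; apply: esum_ge0 => y _; rewrite mule_ge0. Qed.

Lemma le_average f g x : (forall y, f y <= g y) -> average f x <= average g x.
Proof. by move=> fg; apply: le_esum => y _; rewrite lee_wpmul2l. Qed.

Lemma eq_average f g x : f =1 g -> average f x = average g x.
Proof. by move=> fg; apply: eq_esum => y _; rewrite fg. Qed.

Lemma averageD f g x : (forall y, 0 <= f y) -> (forall y, 0 <= g y) ->
  average (fun y => f y + g y) x = average f x + average g x.
Proof.
move=> f0 g0; rewrite /average -esumD//; try by move=> y _; rewrite mule_ge0.
by apply: eq_esum => y _; rewrite ge0_muleDr.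
Qed.

Lemma averageZ (c : R) f x : (0 <= c)%R -> (forall y, 0 <= f y) ->
  average (fun y => c%:E * f y) x = c%:E * average f x.
Proof.
move=> c0 f0; rewrite /average -esumZl//; last by move=> y; rewrite mule_ge0.
by apply: eq_esum => y _; rewrite muleCA.
Qed.

Lemma average_cst (c : R) x : (0 <= c)%R -> average (fun=> c%:E) x = c%:E.
Proof.
move=> c0; rewrite (_ : (fun=> _) = fun _ : V => c%:E * 1); last first.
  by apply/funext => y; rewrite mule1.
rewrite averageZ// /average (eq_esum (b := fun y => (p x y)%:E)).
  by rewrite p_tm.2 mule1.
by move=> y _; rewrite mule1.
Qed.

Lemma average_esum (T : choiceType) (A : set T) (f : T -> V -> \bar R) x :
  (forall t y, 0 <= f t y) ->
  average (fun y => \esum_(t in A) f t y) x = \esum_(t in A) average (f t) x.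
Proof.
move=> f0; rewrite /average -esum_exchange; last first.
  by move=> *; rewrite mule_ge0.
by apply: eq_esum => y _; rewrite esumZl// -lee_fin.
Qed.

Lemma le_term_average f x y : (forall z, 0 <= f z) ->
  (p x y)%:E * f y <= average f x.
Proof.
move=> f0; apply: esum_ge; exists [set y]; last by rewrite fsbig_set1.
by split; [exact: finite_set1|exact: subsetT].
Qed.

End average_theory.

(** * Avoiding a set, and geometric tails of the return time *)

Section avoidance.
Local Open Scope classical_set_scope.
Local Open Scope ring_scope.
Local Open Scope ereal_scope.
Variables (R : realType) (V : countType) (p : V -> V -> R) (K : set V).

(** The probability of [X_1, ..., X_n \notin K], that is of [T_K > n]; the
    starting point itself may lie in [K]. *)
Fixpoint avoid (n : nat) : V -> \bar R :=
  if n is m.+1 then average p (fun y => if y \in K then 0 else avoid m y)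
  else fun=> 1.

(** The expectation of [rho ^ (n - T_K)] on the event [T_K <= n]: one unit of
    mass is released at the first return to [K] and then discounted. *)
Fixpoint discounted_return (rho : R) (n : nat) : V -> \bar R :=
  if n is m.+1 then
    average p (fun y => if y \in K then (rho ^+ m)%:E
                        else discounted_return rho m y)
  else fun=> 0.

Definition occupation (n : nat) (x : V) : \bar R :=
  \esum_(y in K) nstep p n x y.

(** Common ground of geometric convergence and of exponential moments of the
    return time. *)
Definition geometric_tail : Prop :=
  exists theta B : R, (0 < theta < 1)%R /\
    forall x, K x -> forall n, avoid n x <= (B * theta ^+ n)%:E.

Lemma avoidS n x :
  avoid n.+1 x = average p (fun y => if y \in K then 0 else avoid n y) x.
Proof. by []. Qed.

Lemma discounted_returnS rho n x :
  discounted_return rho n.+1 x =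
  average p (fun y => if y \in K then (rho ^+ n)%:E
                      else discounted_return rho n y) x.
Proof. by []. Qed.

Arguments avoid : simpl never.
Arguments discounted_return : simpl never.

Hypothesis p_tm : transition_matrix p.

Lemma avoid_ge0 n x : 0 <= avoid n x.
Proof.
elim: n x => [|n IH] x; first exact: lee01.
by rewrite avoidS; apply: average_ge0 => // y; case: ifP.
Qed.

Lemma avoid_le1 n x : avoid n x <= 1.
Proof.
elim: n x => [//|n IH] x; rewrite avoidS -(average_cst p_tm x (@ler01 R)).
by apply: le_average => // y; case: ifP => _; rewrite ?lee01.
Qed.

Lemma nstep_ge0 n x y : 0 <= nstep p n x y.
Proof.
elim: n x => [|n IH] x /=; first by rewrite lee_fin.
by apply: esum_ge0 => z _; rewrite mule_ge0// lee_fin p_tm.1.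
Qed.

Lemma occupation_ge0 n x : 0 <= occupation n x.
Proof. by apply: esum_ge0 => y _; exact: nstep_ge0. Qed.

Lemma occupationS n x : occupation n.+1 x = average p (occupation n) x.
Proof.
by rewrite /occupation average_esum// => *; exact: nstep_ge0.
Qed.

Lemma occupation0 x : occupation 0 x = if x \in K then 1 else 0.
Proof.
rewrite /occupation /=; case: ifPn => [|/negP xK].
  rewrite inE => xK; rewrite (esumID [set x]); last by move=> *; rewrite lee_fin.
  rewrite (_ : K `&` [set x] = [set x]); last first.
    by apply/seteqP; split => [y []//|y ->].
  rewrite esum_set1 ?eqxx ?lee_fin// esum1 ?adde0// => y [_ /= yx].
  by rewrite eq_sym; case: eqP.
rewrite esum1// => y yK; case: eqP => // xy; case: xK.
by rewrite inE xy.
Qed.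

Variable rho : R.
Hypothesis rho01 : (0 <= rho < 1)%R.

Let rho_ge0 : (0 <= rho)%R. Proof. by case/andP: rho01. Qed.
Let rho_le1 : (rho <= 1)%R. Proof. by case/andP: rho01 => _ /ltW. Qed.

Lemma discounted_return_ge0 n x : 0 <= discounted_return rho n x.
Proof.
elim: n x => [//|n IH] x; rewrite discounted_returnS.
by apply: average_ge0 => // y; case: ifP => // _; rewrite lee_fin exprn_ge0.
Qed.

Lemma discounted_return_le1 n x : discounted_return rho n x <= 1.
Proof.
elim: n x => [|n IH] x; first exact: lee01.
rewrite discounted_returnS -(average_cst p_tm x (@ler01 R)).
apply: le_average => // y; case: ifP => // _.
by rewrite lee_fin exprn_ile1.
Qed.

(** The mass that has not yet returned is not discounted, and what returns at
    time [n.+1] passes from [avoid] to [discounted_return] at full weight. *)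
Lemma discounted_return_balance n x :
  discounted_return rho n.+1 x + avoid n.+1 x =
  rho%:E * discounted_return rho n x + avoid n x.
Proof.
elim: n x => [|n IH] x.
  rewrite mule0 add0e discounted_returnS avoidS -averageD//; last 2 first.
  - by move=> y; case: ifP.
  - by move=> y; case: ifP.
  rewrite -[RHS](average_cst p_tm x (@ler01 R)).
  by apply: eq_average => y; case: ifP; rewrite ?expr0 ?adde0 ?add0e.
have d0 := discounted_return_ge0; have a0 := avoid_ge0.
have split0 m y :
    0 <= if y \in K then (rho ^+ m)%:E else discounted_return rho m y.
  by case: ifP => // _; rewrite lee_fin exprn_ge0.
have avoid0 m y : 0 <= if y \in K then 0 else avoid m y by case: ifP.
rewrite discounted_returnS avoidS -averageD//.
have split0n := split0 n; have avoid0n := avoid0 n.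
rewrite [in RHS]discounted_returnS [in RHS]avoidS -averageZ// -averageD//;
  last by move=> y; rewrite mule_ge0// lee_fin.
apply: eq_average => y; case: ifP => _.
  by rewrite !adde0 -EFinM exprS.
by rewrite -[RHS]IH.
Qed.

(** The first-return decomposition of [P^n(x, K) - nu]: a path that has not
    returned to [K] contributes [- nu], and one that returned at time [m]
    contributes at most [M rho^(n - m)].  For [n = 0] and [x \in K] the left
    side is [1 + nu], whence the last hypothesis. *)
Lemma occupation_avoid_le (nu M : R) n x : (0 <= nu)%R -> (0 <= M)%R ->
  (forall x, K x -> forall n, occupation n x <= (nu + M * rho ^+ n)%:E) ->
  (x \in K -> (0 < n)%N) ->
  occupation n x + nu%:E * avoid n x <=
  nu%:E + M%:E * discounted_return rho n x.
Proof.
move=> nu0 M0 occ; elim: n x => [|n IH] x.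
  rewrite occupation0; case: ifP => [_ /(_ isT)//|_ _].
  by rewrite add0e mule1 mule0 adde0.
move=> _; have d0 := discounted_return_ge0; have a0 := avoid_ge0.
have avoid0 y : 0 <= if y \in K then 0 else avoid n y by case: ifP.
have split0 y :
    0 <= if y \in K then (rho ^+ n)%:E else discounted_return rho n y.
  by case: ifP => // _; rewrite lee_fin exprn_ge0.
rewrite occupationS avoidS discounted_returnS -averageZ// -averageD//; last 2 first.
- by move=> y; exact: occupation_ge0.
- by move=> y; rewrite mule_ge0.
rewrite -[X in _ <= X + _](average_cst p_tm x nu0) -averageZ// -averageD//; last first.
  by move=> y; rewrite mule_ge0.
apply: le_average => // y; case: ifPn => yK.
  by rewrite mule0 adde0 -EFinM -EFinD; apply: occ; rewrite inE in yK.
by apply: IH; rewrite (negbTE yK).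
Qed.

End avoidance.

(** * Geometric convergence *)

(** The sum [e + a] loses [(1 - rho) * e n] at step [n], and domination makes
    [e n] at least the fraction [nu / (nu + M)] of [e n + a n]. *)
Lemma balance_geometric (R : realType) (a e : nat -> R) (nu M rho : R) :
  (0 < nu)%R -> (0 < M)%R -> (rho < 1)%R ->
  (forall n, e n.+1 + a n.+1 = rho * e n + a n)%R ->
  (forall n, nu * a n <= M * e n)%R ->
  (0 <= 1 - (1 - rho) * nu / (nu + M))%R ->
  forall n, (e n + a n <= (e 0%N + a 0%N) *
                          (1 - (1 - rho) * nu / (nu + M)) ^+ n)%R.
Proof.
move=> nu0 M0 rho1 bal dom; set theta := (X in (0 <= X)%R) => theta0.
have nuM : (0 < nu + M)%R by rewrite addr_gt0.
elim=> [|n IH]; first by rewrite expr0 mulr1.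
rewrite exprSr mulrA; apply: le_trans (ler_wpM2r theta0 IH).
rewrite bal /theta mulrBr mulr1 -subr_ge0.
suff -> : (e n + a n - (e n + a n) * ((1 - rho) * nu / (nu + M)) -
    (rho * e n + a n) = (1 - rho) / (nu + M) * (M * e n - nu * a n))%R.
  by rewrite mulr_ge0 ?subr_ge0// divr_ge0 ?subr_ge0// ltW.
by field; rewrite gt_eqF.
Qed.

Section geometric_convergence.
Local Open Scope classical_set_scope.
Local Open Scope ring_scope.
Local Open Scope ereal_scope.
Variables (R : realType) (V : countType) (p : V -> V -> R).
Hypothesis p_tm : transition_matrix p.

(** Normalization of the constants.  A negative [rho] is possible only if the
    convergence is exact ([M = 0]), so it can be replaced by [0]; enlarging [M]
    beyond [nu] covers [n = 0] in the comparison of [avoid] with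
    [discounted_return]. *)
Lemma geometric_convergence_bounds : geometric_convergence p ->
  exists (K : set V) (nu rho M : R),
    [/\ finite_set K, K !=set0, (0 < nu <= M)%R, (0 <= rho < 1)%R &
        forall x, K x -> forall n,
          (nu - M * rho ^+ n)%:E <= occupation p K n x <=
          (nu + M * rho ^+ n)%:E].
Proof.
move=> [K] [nu] [rho] [M] [finK K0 nu0 rho1 conv].
have conv' n x : K x -> `|occupation p K n x - nu%:E| <= (M * rho ^+ n)%:E.
  move=> Kx; apply: le_trans (conv n); apply: ereal_sup_ubound; exists x => //.
  by rewrite /occupation esum_fset// => y _; exact: nstep_ge0.
have Mrho n : (0 <= M * rho ^+ n)%R.
  have [x Kx] := K0.
  by rewrite -lee_fin; apply: le_trans (conv' n x Kx); exact: abse_ge0.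
have M0 : (0 <= M)%R by have := Mrho 0%N; rewrite expr0 mulr1.
exists K, nu, (Num.max rho 0%R), (M + nu)%R; split => //.
- by rewrite nu0 lerDr.
- by rewrite le_max lexx orbT gt_max rho1 ltr01.
move=> x Kx n.
have Mrho_le : (M * rho ^+ n <= (M + nu) * Num.max rho 0 ^+ n)%R.
  have [rho0|rho0] := leP 0%R rho.
    by rewrite ler_wpM2r ?exprn_ge0// lerDl ltW.
  have -> : M = 0%R.
    apply/le_anti; rewrite M0 andbT -(ler_nM2r rho0) mul0r.
    by have := Mrho 1%N; rewrite expr1.
  by rewrite mul0r add0r mulr_ge0 ?exprn_ge0// ltW.
have := conv' n x Kx; case: (occupation p K n x) => [k| |] //=.
rewrite lee_fin ler_distl !lee_fin => /andP[lo hi]; apply/andP; split; lra.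
Qed.

Lemma geometric_convergence_tail : geometric_convergence p ->
  exists K, [/\ finite_set K, K !=set0 & geometric_tail p K].
Proof.
move=> /geometric_convergence_bounds[K] [nu] [rho] [M].
move=> [finK K0 /andP[nu0 nuM] rho01 occ]; exists K; split => //.
have M0 : (0 < M)%R by exact: lt_le_trans nuM.
have [rho0 rho1] := andP rho01.
have nuM0 : (0 < nu + M)%R by rewrite addr_gt0.
pose theta := (1 - (1 - rho) * nu / (nu + M))%R.
have theta01 : (0 < theta < 1)%R.
  rewrite /theta subr_gt0 ltr_pdivrMr// mul1r gtrBl divr_gt0 ?mulr_gt0 ?subr_gt0//.
  rewrite andbT mulrBl mul1r; have := mulr_ge0 rho0 (ltW nu0); lra.
exists theta, 2%R; split => // x Kx n.
have fin_avoid m : avoid p K m x \is a fin_num.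
  by rewrite ge0_fin_numE ?(le_lt_trans (avoid_le1 _ p_tm _ _)) ?ltry ?avoid_ge0.
have fin_dr m : discounted_return p K rho m x \is a fin_num.
  rewrite ge0_fin_numE ?discounted_return_ge0//.
  exact: le_lt_trans (discounted_return_le1 _ p_tm rho01 _ _) (ltry _).
(* the extra [rho ^+ m] is the error in [k_m >= nu - M rho^m] at [x \in K] *)
pose a m := fine (avoid p K m x).
pose e m := (fine (discounted_return p K rho m x) + rho ^+ m)%R.
have a0 : a 0%N = 1%R by [].
have e0 : e 0%N = 1%R by rewrite /e expr0 add0r.
have bal m : (e m.+1 + a m.+1 = rho * e m + a m)%R.
  have := discounted_return_balance K p_tm rho01 m x.
  rewrite -(fineK (fin_avoid m)) -(fineK (fin_dr m)).
  rewrite -(fineK (fin_avoid m.+1)) -(fineK (fin_dr m.+1)).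
  rewrite -EFinM -!EFinD => -[]; rewrite -/(a m) -/(a m.+1) /e exprS.
  by move=> h; rewrite addrAC h; ring.
have dom m : (nu * a m <= M * e m)%R.
  case: m => [|m]; first by rewrite a0 e0 !mulr1.
  have hi y : K y -> forall k, occupation p K k y <= (nu + M * rho ^+ k)%:E.
    by move=> Ky k; case/andP: (occ y Ky k).
  have := occupation_avoid_le (n := m.+1) (x := x) p_tm rho01 (ltW nu0) (ltW M0)
    hi (fun=> isT).
  have /andP[lo _] := occ x Kx m.+1 => /(le_trans (leeD2r _ lo)).
  rewrite -(fineK (fin_avoid m.+1)) -(fineK (fin_dr m.+1)).
  rewrite -!EFinM -!EFinD lee_fin -/(a m.+1) /e mulrDr; lra.
have := balance_geometric nu0 M0 rho1 bal dom _ n.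
rewrite -/theta a0 e0 => /(_ (ltW (andP theta01).1)) h.
rewrite -(fineK (fin_avoid n)) lee_fin -/(a n); apply: le_trans h.
by rewrite lerDr addr_ge0 ?exprn_ge0// fine_ge0// discounted_return_ge0.
Qed.

End geometric_convergence.

(** * Lyapunov functions *)

Section drift.
Local Open Scope classical_set_scope.
Local Open Scope ring_scope.
Local Open Scope ereal_scope.
Variables (R : realType) (V : countType) (p : V -> V -> R).
Hypothesis p_tm : transition_matrix p.

Lemma drift_weak_chain_compactness :
  geometric_drift p -> weak_chain_compactness p.
Proof.
move=> [K] [b] [lam] [c] [u] [finK lam1 c0 uc drift].
have u0 x : (0 < u x)%R by exact: lt_le_trans (uc x).
have Pu_fin x : Pf p u x < +oo by exact: le_lt_trans (drift x) (ltry _).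
have Pu_ge x : c%:E <= Pf p u x.
  rewrite PfE -(average_cst p_tm x (ltW c0)); exact: le_average.
have Pu_num x : Pf p u x \is a fin_num.
  by rewrite ge0_fin_numE// (le_trans _ (Pu_ge x))// lee_fin ltW.
have Pu0 x : (0 < fine (Pf p u x))%R.
  by rewrite -lte_fin fineK// (lt_le_trans _ (Pu_ge x))// lte_fin.
(* [lam] need not be positive, as it must be to take its logarithm *)
pose l := Num.max lam (1 / 2)%R.
have l0 : (0 < l)%R by rewrite lt_max; apply/orP; right; lra.
have l1 : (l < 1)%R by rewrite gt_max lam1 /=; lra.
have lnl : (ln l < 0)%R by rewrite ln_lt0// l0.
exists (fun=> u), (fun x => u x / fine (Pf p u x))%R; split=> [n x|]; first exact: u0.
split=> [x|]; first by rewrite divr_gt0.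
split.
- by move=> x _; exact: Pu_fin.
- by exists c.
- by move=> x; exists (u x).
- by move=> x; exact: cvg_cst.
- exists (- ln l / 2)%R; first lra.
  apply: (sub_finite_set _ finK) => x /= hx; apply: contrapT => Kx.
  have : (l^-1 <= u x / fine (Pf p u x))%R.
    rewrite ler_pdivlMr// mulrC ler_pdivrMr// -lee_fin fineK//.
    apply: le_trans (drift x) _; rewrite lee_fin.
    rewrite indicE memNset// mulr0 addr0 mulrC ler_pM2l//.
    by rewrite le_max lexx.
  rewrite -ler_ln ?posrE ?invr_gt0 ?divr_gt0// lnV ?posrE//.
  by move: hx lnl; set t := ln (_ / _); lra.
Qed.

Lemma irreducible_closed (D : set V) : irreducible p -> D !=set0 ->
  (forall x y, D x -> (0 < p x y)%R -> D y) -> D = setT.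
Proof.
move=> irr [x0 Dx0] closed; apply/seteqP; split => // y _.
have [n] := irr x0 y; elim: n x0 Dx0 => [|n IH] x Dx /=.
  by rewrite lte_fin; case: eqP => [<-//|_]; rewrite ltxx.
rewrite lt_neqAle eq_sym => /andP[/eqP nz _].
have [z [pz nz']] : exists z, (0 < p x z)%R /\ 0 < nstep p n z y.
  apply: contrapT => none; apply: nz; apply: esum1 => z _.
  have := nstep_ge0 p_tm n z y; rewrite le_eqVlt => /predU1P[<-|n0].
    by rewrite mule0.
  have := p_tm.1 x z; rewrite le_eqVlt => /predU1P[<-|p0].
    by rewrite mul0e.
  by case: none; exists z.
exact: IH (closed _ _ Dx pz) nz'.
Qed.

(** The Lyapunov function is the generating function of the tail of [T_K] off
    [K]; on [K] it is [kappa^-1], so that averaging it stays below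
    [kappa^-1 * G], including the constant term [1] of [G]. *)
Lemma geometric_tail_drift (K : set V) : irreducible p ->
  finite_set K -> K !=set0 -> geometric_tail p K -> geometric_drift p.
Proof.
move=> irr finK K0 [theta] [B] [/andP[theta0 theta1] tail].
(* [kappa] lies strictly between [1] and [theta^-1] *)
pose kappa := (2 / (1 + theta))%R.
have k0 : (0 < kappa)%R by rewrite divr_gt0//; lra.
have k1 : (1 < kappa)%R by rewrite ltr_pdivlMr; lra.
have kt : (0 < kappa * theta < 1)%R.
  by rewrite mulr_gt0//= mulrAC ltr_pdivrMr; lra.
have [x0 Kx0] := K0.
have B0 : (0 <= B)%R.
  have := tail x0 Kx0 0%N; rewrite expr0 mulr1 => /(le_trans (avoid_ge0 K p_tm _ _)).
  by rewrite lee_fin.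
pose G (x : V) : \bar R := \esum_(n in [set: nat]) ((kappa ^+ n)%:E * avoid p K n x).
have kn0 n : (0 <= kappa ^+ n)%R by rewrite exprn_ge0// ltW.
have avoid0 n y : 0 <= if y \in K then 0 else avoid p K n y.
  by case: ifP => // _; exact: avoid_ge0.
have kavoid0 n y : 0 <= (kappa ^+ n)%:E * if y \in K then 0 else avoid p K n y.
  by rewrite mule_ge0// lee_fin.
have term0 n x : 0 <= (kappa ^+ n)%:E * avoid p K n x.
  by rewrite mule_ge0 ?avoid_ge0// lee_fin.
have G0 x : 0 <= G x by apply: esum_ge0.
have GK x : K x -> G x <= (B / (1 - kappa * theta))%:E.
  move=> Kx; apply: esum_geometric_le => // n; rewrite term0 /=.
  have -> : (B * (kappa * theta) ^+ n = kappa ^+ n * (B * theta ^+ n))%R.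
    by rewrite exprMn mulrCA.
  rewrite EFinM; apply: lee_wpmul2l (tail x Kx n).
  by rewrite lee_fin.
have restr0 y : 0 <= if y \in K then 0 else G y by case: ifP.
have Grec x : G x = 1 + kappa%:E * average p (fun y => if y \in K then 0 else G y) x.
  rewrite /G esum_nat_recl// mul1e; congr (_ + _).
  rewrite (eq_average _ (g := fun y => \esum_(n in [set: nat])
      ((kappa ^+ n)%:E * if y \in K then 0 else avoid p K n y))); last first.
    by move=> y; case: ifP => // _; rewrite esum1// => n _; rewrite mule0.
  rewrite average_esum// -esumZl ?(ltW k0)//; last first.
    by move=> n; exact: average_ge0.
  apply: eq_esum => n _; rewrite averageZ//.
  by rewrite muleA -EFinM -exprS.
have Gfin : [set x | G x < +oo] = setT.
  apply: irreducible_closed => //.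
    by exists x0; exact: le_lt_trans (GK x0 Kx0) (ltry _).
  move=> x y /= Gx pxy; have [yK|yK] := boolP (y \in K).
    by rewrite inE in yK; exact: le_lt_trans (GK y yK) (ltry _).
  (* the term of index [y] in [Grec] at [x] is finite *)
  have term : (kappa * p x y)%:E * G y <= G x.
    rewrite [leRHS]Grec EFinM -muleA -[leLHS]add0e leeD ?lee01//.
    rewrite lee_pmul2l ?lte_fin//.
    by have := le_term_average p x y restr0; rewrite (negbTE yK).
  rewrite ltey; apply/negP => /eqP Gy; move: (le_lt_trans term Gx).
  have kp : 0 < (kappa * p x y)%:E by rewrite lte_fin mulr_gt0.
  by rewrite Gy gt0_muley// ltxx.
have Gnum x : G x \is a fin_num.
  by rewrite ge0_fin_numE//; have : [set x | G x < +oo] x by rewrite Gfin.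
have G1 x : 1 <= G x.
  by rewrite Grec leeDl// mule_ge0 ?average_ge0// lee_fin ltW.
pose u x := if x \in K then kappa^-1%R else fine (G x).
have Pu x : Pf p u x <= (kappa^-1)%:E * G x.
  have kV0 : (0 <= kappa^-1)%R by rewrite invr_ge0 ltW.
  rewrite [in leRHS]Grec ge0_muleDr ?lee01//; last first.
    by rewrite mule_ge0 ?average_ge0// lee_fin ltW.
  rewrite mule1 muleA -EFinM mulVf ?gt_eqF// mul1e PfE.
  rewrite -[X in X + _](average_cst p_tm x kV0) -averageD//.
  apply: le_average => // y; rewrite /u /=; case: ifP => _; first by rewrite adde0.
  by rewrite fineK// leeDr// lee_fin.
exists K, (B / (1 - kappa * theta))%R, kappa^-1%R, kappa^-1%R, u; split => //.
- by rewrite invf_lt1.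
- by rewrite invr_gt0.
- move=> x; rewrite /u; case: ifP => // _.
  apply: (@le_trans _ _ 1%R); first by rewrite invf_le1// ltW.
  by rewrite -lee_fin fineK.
- move=> x; apply: le_trans (Pu x) _; rewrite indicE /u.
  case: ifPn => xK; last by rewrite mulr0 addr0 EFinM fineK.
  rewrite mulr1; apply: (@le_trans _ _ (G x)).
    rewrite -[leRHS]mul1e lee_wpmul2r// lee_fin invf_le1// ltW//.
  rewrite inE in xK; apply: le_trans (GK x xK) _.
  by rewrite lee_fin lerDr mulr_ge0// invr_ge0 ltW.
Qed.

End drift.

(** * Exponential moments of the return time *)

Section exponential_return.
Local Open Scope classical_set_scope.
Local Open Scope ring_scope.
Local Open Scope ereal_scope.

Import HBNNSimple.

(** Markov's inequality: the integral of [f] is a supremum over the simple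
    functions below [f], and [c 1_C] is one of them. *)
Lemma le_integral_on (R : realType) (d : measure_display) (T : measurableType d)
    (mu : {measure set T -> \bar R}) (f : T -> \bar R) (C : set T) (c : R) :
  measurable C -> (0 <= c)%R -> (forall t, 0 <= f t) ->
  (forall t, C t -> c%:E <= f t) ->
  c%:E * mu C <= \int[mu]_t f t.
Proof.
move=> mC c0 f0 cf; rewrite ge0_integralTE//; apply: ereal_sup_ubound => /=.
exists (scale_nnsfun (indic_nnsfun R mC) c0) => [t /=|].
  rewrite measurable_realfun.mindicE.
  have [tC|tC] := boolP (t \in C); last by rewrite mulr0.
  by rewrite mulr1; apply: cf; rewrite inE in tC.
by rewrite sintegralrM sintegral_indic.
Qed.

Variables (R : realType) (V : countType) (p : V -> V -> R).
Variables (d : measure_display) (Omega : measurableType d).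
Variables (Pr : V -> probability Omega R) (X : nat -> Omega -> V).
Hypothesis hX : markov_chain p Pr X.

Let p_tm : transition_matrix p. Proof. by case: hX. Qed.

Definition starts_with (s : nat -> V) (m : nat) : set Omega :=
  [set w | forall i, (i <= m)%N -> X i w = s i].

Definition avoids (K : set V) (m n : nat) : set Omega :=
  [set w | forall i, (m < i <= m + n)%N -> ~ K (X i w)].

Lemma measurable_starts_with s m : measurable (starts_with s m).
Proof.
have -> : starts_with s m = \bigcap_(i in [set i | (i <= m)%N]) (X i @^-1` [set s i]).
  by apply/seteqP; split.
by apply: bigcap_measurableType => i _; case: hX.
Qed.

Lemma measurable_avoids K m n : finite_set K -> measurable (avoids K m n).
Proof.
move=> finK.
have -> : avoids K m n =
    \bigcap_(i in [set i | (m < i <= m + n)%N])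
      ~` (\bigcup_(y in K) (X i @^-1` [set y])).
  apply/seteqP; split=> w /= h i mi.
    by move=> [y Ky /= Xy]; apply: (h i mi); rewrite Xy.
  by move=> KX; apply: (h i mi); exists (X i w).
apply: bigcap_measurableType => i _; apply: measurableC.
by apply: fin_bigcup_measurable => // y _; case: hX.
Qed.

(** The taboo probabilities are realized by the chain.  The induction on [n]
    needs the chain to have any past [s_0, ..., s_m], since its step extends the
    past by one point.  As an unordered sum is a supremum of finite sums,
    finite additivity gives the inequality. *)
Lemma avoid_le_prob (K : set V) x n s m : finite_set K ->
  Pr x (starts_with s m) * avoid p K n (s m) <=
  Pr x (starts_with s m `&` avoids K m n).
Proof.
move=> finK; elim: n s m => [|n IH] s m.
  rewrite mule1 le_measure ?inE//; first exact: measurable_starts_with.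
    by apply: measurableI; [exact: measurable_starts_with|exact: measurable_avoids].
  by move=> w sw; split => // i; rewrite addn0 => /andP[/leq_trans h /h]; rewrite ltnn.
(* [E y] is the part of the event with [X_(m+1) = y] *)
pose ext y i := if (i <= m)%N then s i else y.
pose E y := if y \in K then set0
            else starts_with (ext y) m.+1 `&` avoids K m.+1 n.
have mE y : measurable (E y).
  rewrite /E; case: ifP => // _.
  by apply: measurableI; [exact: measurable_starts_with|exact: measurable_avoids].
have ext_last y : ext y m.+1 = y by rewrite /ext ltnn.
have ext_m y : ext y m = s m by rewrite /ext leqnn.
have ext_prob y : Pr x (starts_with (ext y) m.+1) =
    Pr x (starts_with s m) * (p (s m) y)%:E.
  case: hX => _ _ _ /(_ x m (ext y)); rewrite -!/(starts_with _ _) ext_last ext_m => ->.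
  congr (Pr x _ * _); apply/seteqP; split => w h i im.
    by rewrite h// /ext im.
  by rewrite h// /ext im.
have Pfin : Pr x (starts_with s m) \is a fin_num.
  by apply: fin_num_measure; exact: measurable_starts_with.
have avoid0 y : 0 <= if y \in K then 0 else avoid p K n y.
  by case: ifP => // _; exact: avoid_ge0.
rewrite avoidS -(fineK Pfin) /average -esumZl ?fine_ge0//; last first.
  by move=> y; rewrite mule_ge0// lee_fin p_tm.1.
apply: ge_ereal_sup => _ [A [finA _] <-].
apply: (@le_trans _ _ (\sum_(y \in A) Pr x (E y))).
  apply: lee_fsum => // y _; rewrite fineK// muleA -ext_prob /E.
  case: ifP => _; first by rewrite mule0 measure0.
  by rewrite -{2}(ext_last y); exact: IH.
rewrite -measure_fin_bigcup//; last first.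
  move=> y z _ _ [w []]; rewrite /E; case: ifP => // _ [+ _].
  case: ifP => // _ + [+ _] => /(_ m.+1 (leqnn _)) + /(_ m.+1 (leqnn _)).
  by rewrite !ext_last => <- <-.
rewrite le_measure ?inE//.
- exact: fin_bigcup_measurable.
- by apply: measurableI; [exact: measurable_starts_with|exact: measurable_avoids].
move=> w [y _]; rewrite /E; case: ifPn => // /negP yK [sw aw]; split.
  by move=> i im; rewrite sw ?/ext ?im// leqW.
move=> i /andP[mi imn]; have [im|im] := ltnP m.+1 i.
  by apply: aw; rewrite im addSnnS.
have -> : i = m.+1 by apply/eqP; rewrite eqn_leq im mi.
by rewrite sw// ext_last => Ky; apply: yK; rewrite inE.
Qed.

Lemma powRe_ge0 (a : R) t : 0 <= powRe a t.
Proof. by case: t => [r| |] //=; rewrite lee_fin powR_ge0. Qed.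

Lemma powRe_ge (a : R) (n : nat) t : (1 <= a)%R -> n%:R%:E <= t ->
  (a ^+ n)%:E <= powRe a t.
Proof.
move=> a1; case: t => [r| |] //=; rewrite ?leey// !lee_fin => nr.
by rewrite -powR_mulrn ?ler_powR// (le_trans _ a1).
Qed.

Lemma exponential_return_tail : exponential_return Pr X ->
  exists K, [/\ finite_set K, K !=set0 & geometric_tail p K].
Proof.
move=> [K] [kappa] [finK K0 k1 sup_fin]; exists K; split => //.
have k0 : (0 < kappa)%R by exact: lt_trans k1.
set B := ereal_sup _ in sup_fin.
have leB x : K x -> \int[Pr x]_w powRe kappa (return_time R X K w) <= B.
  by move=> Kx; apply: ereal_sup_ubound; exists x.
have B0 : 0 <= B.
  have [x Kx] := K0; apply: le_trans (leB x Kx).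
  by apply: integral_ge0 => w _; exact: powRe_ge0.
have Bfin : B \is a fin_num by rewrite ge0_fin_numE.
exists kappa^-1%R, (fine B); split; first by rewrite invr_gt0 k0 invf_lt1.
move=> x Kx n; have kn0 : (0 < kappa ^+ n)%R by rewrite exprn_gt0.
suff h : (kappa ^+ n)%:E * avoid p K n x <= B.
  rewrite exprVn EFinM fineK// muleC -(@lee_pmul2l _ (kappa ^+ n)%:E) ?lte_fin//.
  by rewrite muleA -EFinM divff ?gt_eqF// mul1e.
apply: le_trans (leB x Kx).
pose C := starts_with (fun=> x) 0 `&` avoids K 0 n.
apply: (@le_trans _ _ ((kappa ^+ n)%:E * Pr x C)).
  rewrite lee_pmul2l ?lte_fin//.
  have := avoid_le_prob x n (fun=> x) 0 finK.
  suff -> : Pr x (starts_with (fun=> x) 0) = 1 by rewrite mul1e.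
  case: hX => _ _ /(_ x) <- _; congr (Pr x _).
  apply/seteqP; split => w; first by move=> /(_ 0%N (leqnn _)).
  by move=> h [|i].
apply: le_integral_on => //.
- by apply: measurableI; [exact: measurable_starts_with|exact: measurable_avoids].
- exact: ltW.
- by move=> w; exact: powRe_ge0.
- move=> w [_ aw]; apply: powRe_ge; first exact: ltW.
  apply: le_ereal_inf_tmp => _ [i [i0 Ki] <-]; rewrite lee_fin ler_nat.
  rewrite leqNgt; apply/negP => ni; apply: (aw i) => //.
  by rewrite i0 add0n ltnW.
Qed.

End exponential_return.

Unset Implicit Arguments.

Theorem corollary3p11 (R : realType) (V : countType) (p : V -> V -> R)
    (d : measure_display) (Omega : measurableType d)
    (Pr : V -> probability Omega R) (X : nat -> Omega -> V)
    (hX : markov_chain p Pr X) :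
  (geometric_drift p -> weak_chain_compactness p) /\
  (irreducible p -> aperiodic p ->
     geometric_convergence p \/ exponential_return Pr X \/ geometric_drift p ->
     weak_chain_compactness p).
Proof.
have p_tm : transition_matrix p by case: hX.
split; first exact: drift_weak_chain_compactness.
move=> irr _ cond; apply: drift_weak_chain_compactness => //.
have from_tail :
    (exists K, [/\ finite_set K, (K !=set0)%classic & geometric_tail p K]) ->
    geometric_drift p.
  by move=> [K [finK K0]]; exact: geometric_tail_drift.
case: cond => [/(geometric_convergence_tail p_tm)/from_tail//|[|//]].
by move=> /(exponential_return_tail hX)/from_tail.
Qed.
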